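(* For any Rademacher sum $X=\sum_{i=1}^na_i\varepsilon_i\in\mathcal{X}$, we have $\mathbb{P}(|X|\geq 2/\sqrt{6})\geq 1/4$.
   Context: $\mathcal{X}$ denotes the set of Rademacher sums $X=\sum_{i=1}^na_i\varepsilon_i$ where $a_1\geq a_2\geq\dots\geq a_n>0$ are real constants with $a_1^2+\dots+a_n^2=1$ (i.e. $\mathrm{Var}(X)=1$), and the $\varepsilon_i$ are independent random signs uniformly distributed on $\{-1,+1\}$. *)

(* Defs.v *)
From HB Require Import structures.
From mathcomp Require Import all_boot all_order all_algebra.
From mathcomp Require Import all_classical all_reals all_analysis.

Set Implicit Arguments.
Unset Strict Implicit.
Unset Printing Implicit Defensive.

Import Order.TTheory GRing.Theory Num.Theory.
Import numFieldNormedType.Exports.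

Local Open Scope classical_set_scope.
Local Open Scope ring_scope.

Section RademacherSums.
Context {d : measure_display} {T : measurableType d} {R : realType}.
Variable P : probability T R.

Definition mutually_independent (I : finType) (X : I -> {RV P >-> R}) : Prop :=
  forall (J : {set I}) (B : I -> set R), (forall i, measurable (B i)) ->
    P (\bigcap_(i in [set` J]) X i @^-1` B i)
    = (\prod_(i in J) P (X i @^-1` B i))%E.

Definition random_sign (e : {RV P >-> R}) : Prop :=
  P (e @^-1` [set 1]) = (2^-1)%:E /\ P (e @^-1` [set -1]) = (2^-1)%:E.

Definition rademacher_weights (n : nat) (a : 'I_n -> R) : Prop :=
  [/\ forall i j : 'I_n, (i <= j)%N -> a j <= a i,
      forall i, 0 < a i
    & \sum_(i < n) a i ^+ 2 = 1].

Definition rademacher_sum (n : nat) (a : 'I_n -> R)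
    (e : 'I_n -> {RV P >-> R}) (w : T) : R :=
  \sum_(i < n) a i * e i w.

End RademacherSums.

(* Main.v *)
(** Write t = sqrt (2/3).  It suffices to bound the one-sided tail from below by 1/8,
    for every decreasing list of positive weights and every threshold at most t times
    its standard deviation; this is done by induction on the list, scaled to variance 1.

    If a1 + a2 >= t, fix the first two signs to +.  Otherwise, if a6 >= t/3, condition on
    the first six signs.  Two sign patterns whose sums add up to at least 2t contribute
    together at least as much as one certain success, and seven disjoint such pairs exist;
    nine further patterns fall short of t by at most t times the standard deviation of the
    remaining weights, so each contributes 1/8 by induction.  In total (7 + 9/8)/64 > 1/8.

    In the remaining case all weights but five are less than t/3, and the sum of squares
    of these five is at most 5/6.  The indicator of |x| >= t is minorised by a trigonometric
    polynomial in (3/2)x of degree 5, and the expectation of cos (u X) is the product of the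
    cos (u a_i): the product at u = 3/2 is at most about exp (-9/8), and those at the
    higher frequencies 9/2, 6 and 15/2 are small. *)

Require Import Defs.
From mathcomp Require Import all_boot all_order all_algebra.
From mathcomp Require Import all_classical all_reals all_analysis.
From mathcomp Require Import measurable_realfun ring lra.

Set Implicit Arguments.
Unset Strict Implicit.
Unset Printing Implicit Defensive.

Import Order.TTheory GRing.Theory Num.Theory.
Import numFieldNormedType.Exports.

Local Open Scope classical_set_scope.
Local Open Scope ring_scope.

(** * Taylor bounds *)

Lemma ge0_of_derive_ge0 (R : realType) (f g : R -> R) :
  (forall x : R, is_derive x 1 f (g x)) -> 0 <= f 0 ->
  (forall x, 0 <= x -> 0 <= g x) -> forall x, 0 <= x -> 0 <= f x.
Proof.
move=> df f0 g0 x x0; apply: (le_trans f0).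
apply: (@ger0_derive1_ndecry _ f 0) => // [y|].
- rewrite in_itv/= andbT => y0; rewrite derive1E (@derive_val _ _ _ _ _ _ _ (df y)).
  exact/g0/ltW.
- apply: continuous_subspaceT => y.
  exact/differentiable_continuous/derivable1_diffP/ex_derive.
Qed.

Lemma is_derive_monomial (R : realType) (c : R) (n : nat) (x : R) :
  is_derive x 1 (fun y : R => c * y ^+ n) (c * (n%:R * x ^+ n.-1)).
Proof.
have h := is_deriveZ c (is_deriveX n (is_derive_id x (1 : R))).
rewrite (_ : (fun y => c * y ^+ n) = c \*: (@id R) ^+ n).
  by apply: is_derive_eq; rewrite /GRing.scale/= mulr1.
by apply/funext => y; rewrite fctE.
Qed.

Lemma sin_le_id (R : realType) (x : R) : 0 <= x -> sin x <= x.
Proof.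
move=> x0; rewrite -subr_ge0.
apply: (@ge0_of_derive_ge0 _ (fun y => y - sin y) (fun y => 1 - cos y) _ _ _ x x0).
- by rewrite sin0 subrr.
- by move=> y _; rewrite subr_ge0 cos_le1.
Qed.

Lemma cos_ge2 (R : realType) (x : R) : 0 <= x -> 1 - 2^-1 * x ^+ 2 <= cos x.
Proof.
move=> x0; rewrite -subr_ge0.
apply: (@ge0_of_derive_ge0 _ (fun y => cos y - (1 - 2^-1 * y ^+ 2))
  (fun y => - sin y + 2^-1 * (2%:R * y ^+ 1)) _ _ _ x x0).
- move=> y; have h := is_derive_monomial (2^-1 : R) 2 y.
  by apply: is_derive_eq; lra.
- by rewrite cos0 expr0n/=; lra.
- move=> y y0; have := sin_le_id y0; lra.
Qed.

Lemma sin_ge3 (R : realType) (x : R) : 0 <= x -> x - 6^-1 * x ^+ 3 <= sin x.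
Proof.
move=> x0; rewrite -subr_ge0.
apply: (@ge0_of_derive_ge0 _ (fun y => sin y - (y - 6^-1 * y ^+ 3))
  (fun y => cos y - (1 - 6^-1 * (3%:R * y ^+ 2))) _ _ _ x x0).
- move=> y; have h := is_derive_monomial (6^-1 : R) 3 y.
  by apply: is_derive_eq; lra.
- by rewrite sin0 expr0n/=; lra.
- move=> y y0; have := cos_ge2 y0; lra.
Qed.

Lemma cos_le4 (R : realType) (x : R) : 0 <= x ->
  cos x <= 1 - 2^-1 * x ^+ 2 + 24^-1 * x ^+ 4.
Proof.
move=> x0; rewrite -subr_ge0.
apply: (@ge0_of_derive_ge0 _ (fun y => 1 - 2^-1 * y ^+ 2 + 24^-1 * y ^+ 4 - cos y)
  (fun y => - (2^-1 * (2%:R * y ^+ 1)) + 24^-1 * (4%:R * y ^+ 3) + sin y) _ _ _ x x0).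
- move=> y; have h := is_derive_monomial (2^-1 : R) 2 y.
  have h' := is_derive_monomial (24^-1 : R) 4 y.
  by apply: is_derive_eq; lra.
- by rewrite cos0 !expr0n/=; lra.
- move=> y y0; have := sin_ge3 y0; lra.
Qed.

Lemma sin_le5 (R : realType) (x : R) : 0 <= x ->
  sin x <= x - 6^-1 * x ^+ 3 + 120^-1 * x ^+ 5.
Proof.
move=> x0; rewrite -subr_ge0.
apply: (@ge0_of_derive_ge0 _ (fun y => y - 6^-1 * y ^+ 3 + 120^-1 * y ^+ 5 - sin y)
  (fun y => 1 - (6^-1 * (3%:R * y ^+ 2)) + 120^-1 * (5%:R * y ^+ 4) - cos y) _ _ _ x x0).
- move=> y; have h := is_derive_monomial (6^-1 : R) 3 y.
  have h' := is_derive_monomial (120^-1 : R) 5 y.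
  by apply: is_derive_eq; lra.
- by rewrite sin0 !expr0n/=; lra.
- move=> y y0; have := cos_le4 y0; lra.
Qed.

Lemma cos_ge6 (R : realType) (x : R) : 0 <= x ->
  1 - 2^-1 * x ^+ 2 + 24^-1 * x ^+ 4 - 720^-1 * x ^+ 6 <= cos x.
Proof.
move=> x0; rewrite -subr_ge0.
apply: (@ge0_of_derive_ge0 _
  (fun y => cos y - (1 - 2^-1 * y ^+ 2 + 24^-1 * y ^+ 4 - 720^-1 * y ^+ 6))
  (fun y => - sin y - (- (2^-1 * (2%:R * y ^+ 1)) + 24^-1 * (4%:R * y ^+ 3)
    - 720^-1 * (6%:R * y ^+ 5))) _ _ _ x x0).
- move=> y; have h := is_derive_monomial (2^-1 : R) 2 y.
  have h' := is_derive_monomial (24^-1 : R) 4 y.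
  have h'' := is_derive_monomial (720^-1 : R) 6 y.
  by apply: is_derive_eq; lra.
- by rewrite cos0 !expr0n/=; lra.
- move=> y y0; have := sin_le5 y0; lra.
Qed.

Lemma expRN_le2 (R : realType) (x : R) : 0 <= x ->
  expR (- x) <= 1 - x + 2^-1 * x ^+ 2.
Proof.
move=> x0; rewrite -subr_ge0.
apply: (@ge0_of_derive_ge0 _ (fun y => 1 - y + 2^-1 * y ^+ 2 - expR (- y))
  (fun y => - 1 + 2^-1 * (2%:R * y ^+ 1) + expR (- y)) _ _ _ x x0).
- move=> y; have h := is_derive_monomial (2^-1 : R) 2 y.
  by apply: is_derive_eq; lra.
- by rewrite oppr0 expR0 !expr0n/=; lra.
- move=> y y0; have := expR_ge1Dx (- y); lra.
Qed.

Lemma expRN_ge3 (R : realType) (x : R) : 0 <= x ->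
  1 - x + 2^-1 * x ^+ 2 - 6^-1 * x ^+ 3 <= expR (- x).
Proof.
move=> x0; rewrite -subr_ge0.
apply: (@ge0_of_derive_ge0 _
  (fun y => expR (- y) - (1 - y + 2^-1 * y ^+ 2 - 6^-1 * y ^+ 3))
  (fun y => - expR (- y) - (- 1 + 2^-1 * (2%:R * y ^+ 1)
    - 6^-1 * (3%:R * y ^+ 2))) _ _ _ x x0).
- move=> y; have h := is_derive_monomial (2^-1 : R) 2 y.
  have h' := is_derive_monomial (6^-1 : R) 3 y.
  by apply: is_derive_eq; lra.
- by rewrite oppr0 expR0 !expr0n/=; lra.
- move=> y y0; have := expRN_le2 y0; lra.
Qed.

Lemma expRN_le4 (R : realType) (x : R) : 0 <= x ->
  expR (- x) <= 1 - x + 2^-1 * x ^+ 2 - 6^-1 * x ^+ 3 + 24^-1 * x ^+ 4.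
Proof.
move=> x0; rewrite -subr_ge0.
apply: (@ge0_of_derive_ge0 _
  (fun y => 1 - y + 2^-1 * y ^+ 2 - 6^-1 * y ^+ 3 + 24^-1 * y ^+ 4 - expR (- y))
  (fun y => - 1 + 2^-1 * (2%:R * y ^+ 1) - 6^-1 * (3%:R * y ^+ 2)
    + 24^-1 * (4%:R * y ^+ 3) + expR (- y)) _ _ _ x x0).
- move=> y; have h := is_derive_monomial (2^-1 : R) 2 y.
  have h' := is_derive_monomial (6^-1 : R) 3 y.
  have h'' := is_derive_monomial (24^-1 : R) 4 y.
  by apply: is_derive_eq; lra.
- by rewrite oppr0 expR0 !expr0n/=; lra.
- move=> y y0; have := expRN_ge3 y0; lra.
Qed.

Lemma cos_le_expRN4 (R : realType) (y : R) : 0 <= y -> 2 * y ^+ 2 <= 3 ->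
  0 <= cos y <= expR (- (y ^+ 2 / 2 + y ^+ 4 / 12)).
Proof.
move=> y0 y2; have := cos_ge2 y0; have := cos_le4 y0.
rewrite (_ : y ^+ 4 = (y ^+ 2) ^+ 2); last by rewrite -exprM.
have z0 : 0 <= y ^+ 2 by rewrite sqr_ge0.
move: (y ^+ 2) z0 y2 => z z0 z32 up lo; apply/andP; split; first lra.
apply: (le_trans up); have w0 : 0 <= z / 2 + z ^+ 2 / 12 by nra.
apply: le_trans (expRN_ge3 w0); rewrite -subr_ge0.
suff : 0 <= z ^+ 3 * (48^-1 - z / 144 - z ^+ 2 / 576 - z ^+ 3 / 10368).
  by move=> h; apply: le_trans h _; rewrite le_eqVlt; apply/orP; left; apply/eqP; field.
have pw n : z ^+ n <= (3 / 2) ^+ n by apply: lerXn2r; rewrite ?nnegrE//; lra.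
apply: mulr_ge0; first exact: exprn_ge0.
have := pw 2%N; have := pw 3%N; move: (z ^+ 2) (z ^+ 3) => u v.
lra.
Qed.

Lemma norm_cos_le_expRN (R : realType) (k Z y : R) :
  0 <= y -> y ^+ 2 <= Z -> Z <= 9 -> 0 <= k -> 2 * k <= 1 ->
  Z / 2 - 1 - Z ^+ 2 / 24 + Z ^+ 3 / 720 <= expR (- (k * Z)) ->
  `|cos y| <= expR (- (k * y ^+ 2)).
Proof.
move=> y0; have := cos_ge6 y0; have := cos_le4 y0.
rewrite (_ : y ^+ 4 = (y ^+ 2) ^+ 2); last by rewrite -exprM.
rewrite (_ : y ^+ 6 = (y ^+ 2) ^+ 3); last by rewrite -exprM.
have z0 : 0 <= y ^+ 2 by rewrite sqr_ge0.
move: (y ^+ 2) z0 => z z0 up lo zZ Z9 k0 k2 hZ; rewrite ler_norml; apply/andP; split.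
  rewrite lerNl; apply: le_trans (_ : expR (- (k * Z)) <= _); last first.
    by rewrite ler_expR lerN2 ler_wpM2l.
  apply: le_trans hZ.
  suff : 0 <= (Z - z) * (2^-1 - (Z + z) / 24 + (Z ^+ 2 + Z * z + z ^+ 2) / 720) by lra.
  apply: mulr_ge0; first by rewrite subr_ge0.
  have := sqr_ge0 (Z + z - 20); have := sqr_ge0 (Z - z); lra.
apply: (le_trans up); have [z3|z3] := leP z 3; last first.
  by apply: le_trans (ltW (expR_gt0 _)); nra.
apply: le_trans (_ : expR (- (z / 2)) <= _); last first.
  by rewrite ler_expR; nra.
have w0 : 0 <= z / 2 by lra.
apply: le_trans (expRN_ge3 w0).
suff : 0 <= z ^+ 2 * (4 - z) by lra.
apply: mulr_ge0; [exact: exprn_ge0|lra].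
Qed.

Lemma norm_cos_9half (R : realType) (a : R) : 0 <= a -> 6 * a ^+ 2 <= 1 ->
  `|cos (9 / 2 * a)| <= expR (- (39 / 5 * a ^+ 2)).
Proof.
move=> a0 a6.
rewrite (_ : 39 / 5 * a ^+ 2 = 52 / 135 * (9 / 2 * a) ^+ 2); last by field.
apply: (@norm_cos_le_expRN _ _ (27 / 8)); rewrite ?exprMn; try lra.
rewrite (_ : - (52 / 135 * (27 / 8)) = 4%:R * - (13 / 40)) ?expRM_natl; last by field.
have h : 361 / 500 <= expR (- (13 / 40) : R).
  by apply: le_trans (expRN_ge3 _); lra.
apply: le_trans (_ : (361 / 500) ^+ 4 <= _); first lra.
by apply: lerXn2r => //; rewrite nnegrE; lra.
Qed.

Lemma norm_cos_6 (R : realType) (a : R) : 0 <= a -> 27 * a ^+ 2 <= 2 ->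
  `|cos (6 * a)| <= expR (- (18 * a ^+ 2)).
Proof.
move=> a0 a6.
rewrite (_ : 18 * a ^+ 2 = 1 / 2 * (6 * a) ^+ 2); last by field.
apply: (@norm_cos_le_expRN _ _ (8 / 3)); rewrite ?exprMn; try lra.
rewrite (_ : - (1 / 2 * (8 / 3)) = 2%:R * - (2 / 3)) ?expRM_natl; last by field.
have h : 1 / 2 <= expR (- (2 / 3) : R).
  by apply: le_trans (expRN_ge3 _); lra.
apply: le_trans (_ : (1 / 2) ^+ 2 <= _); first lra.
by apply: lerXn2r => //; rewrite nnegrE; lra.
Qed.

Lemma norm_cos_15half (R : realType) (a : R) : 0 <= a -> 27 * a ^+ 2 <= 2 ->
  `|cos (15 / 2 * a)| <= expR (- (52 / 5 * a ^+ 2)).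
Proof.
move=> a0 a6.
rewrite (_ : 52 / 5 * a ^+ 2 = 208 / 1125 * (15 / 2 * a) ^+ 2); last by field.
apply: (@norm_cos_le_expRN _ _ (25 / 6)); rewrite ?exprMn; try lra.
rewrite (_ : - (208 / 1125 * (25 / 6)) = 2%:R * - (52 / 135)) ?expRM_natl; last by field.
have h : 679 / 1000 <= expR (- (52 / 135) : R).
  by apply: le_trans (expRN_ge3 _); lra.
apply: le_trans (_ : (679 / 1000) ^+ 2 <= _); first lra.
by apply: lerXn2r => //; rewrite nnegrE; lra.
Qed.

(** * Averages over signs *)

Section SignAverage.
Variable R : realType.
Implicit Types (l : seq R) (f g : R -> R) (s x y : R).

Fixpoint savg l f s : R :=
  if l is a :: l' then (savg l' f (s - a) + savg l' f (s + a)) / 2 else f s.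

Definition sumsq l : R := \sum_(a <- l) a ^+ 2.

Lemma sumsq_cons a l : sumsq (a :: l) = a ^+ 2 + sumsq l.
Proof. by rewrite /sumsq big_cons. Qed.

Lemma savg_le l f g s : (forall x, f x <= g x) -> savg l f s <= savg l g s.
Proof. by move=> fg; elim: l s => //= a l IH s; rewrite ler_wpM2r// lerD. Qed.

Lemma eq_savg l f g s : f =1 g -> savg l f s = savg l g s.
Proof. by move=> fg; elim: l s => //= a l IH s; rewrite !IH. Qed.

Lemma savgD l f g s : savg l (fun x => f x + g x) s = savg l f s + savg l g s.
Proof. by elim: l s => //= a l IH s; rewrite !IH; lra. Qed.

Lemma savgZ l c f s : savg l (fun x => c * f x) s = c * savg l f s.
Proof. by elim: l s => //= a l IH s; rewrite !IH; lra. Qed.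

Lemma savg_cst l c s : savg l (fun=> c) s = c.
Proof. by elim: l s => //= a l IH s; rewrite !IH; lra. Qed.

Lemma savg_cos l u s :
  savg l (fun x => cos (u * x)) s = cos (u * s) * \prod_(a <- l) cos (u * a).
Proof.
elim: l s => [|a l IH] s /=; first by rewrite big_nil mulr1.
by rewrite !IH big_cons mulrBr mulrDr cosB cosD; lra.
Qed.

Lemma savgN l f s : savg l f (- s) = savg l (fun x => f (- x)) s.
Proof.
elim: l s => //= a l IH s; rewrite -!IH addrC; congr ((_ + _) / 2).
  by rewrite opprB addrC.
by rewrite opprD.
Qed.

Lemma savg_scale l c f s :
  savg [seq c * a | a <- l] f (c * s) = savg l (fun x => f (c * x)) s.
Proof. by elim: l s => //= a l IH s; rewrite -!IH mulrBr mulrDr. Qed.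

Lemma sumsq_scale l c : sumsq [seq c * a | a <- l] = c ^+ 2 * sumsq l.
Proof. by rewrite /sumsq big_map big_distrr/=; apply: eq_bigr => a _; rewrite exprMn. Qed.

(* The probability that x <= \sum_i l_i e_i for independent random signs e_i. *)
Definition tail l x : R := savg l (fun s => (0 <= s)%R%:R) (- x).

Lemma tail_nil x : tail [::] x = (x <= 0)%R%:R.
Proof. by rewrite /tail/= oppr_ge0. Qed.

Lemma tail_cons a l x : tail (a :: l) x = (tail l (x - a) + tail l (x + a)) / 2.
Proof. by rewrite /tail/= opprB opprD addrC (addrC a). Qed.

Lemma tail_ge0 l x : 0 <= tail l x.
Proof. by rewrite -[0](savg_cst l 0 (- x)); apply: savg_le. Qed.

Lemma tail_antimono l x y : x <= y -> tail l y <= tail l x.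
Proof.
elim: l x y => [|a l IH] x y xy; last first.
  by rewrite !tail_cons ler_wpM2r// lerD// IH// ?lerB// lerD.
rewrite !tail_nil ler_nat; case: (leP y 0) => // y0.
by rewrite (le_trans xy y0).
Qed.

Lemma tail_pair l x y : x + y <= 0 -> 1 <= tail l x + tail l y.
Proof.
elim: l x y => [|a l IH] x y xy; last first.
  rewrite !tail_cons.
  have := IH (x - a) (y + a); have := IH (x + a) (y - a); lra.
by rewrite !tail_nil; case: (leP x 0); case: (leP y 0) => /=; lra.
Qed.

Lemma tail_le0 l x : x <= 0 -> 2^-1 <= tail l x.
Proof. by move=> x0; have := @tail_pair l x x; lra. Qed.

Lemma tail_scale l c x : 0 < c -> tail [seq c * a | a <- l] (c * x) = tail l x.
Proof.
move=> c0; rewrite /tail -mulrN savg_scale.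
by apply: eq_savg => y; rewrite pmulr_rge0.
Qed.

Lemma savg_norm_ge l x : 0 < x -> savg l (fun s => (x <= `|s|)%R%:R) 0 = 2 * tail l x.
Proof.
move=> x0.
have shift f s c : savg l f (s + c) = savg l (fun y => f (y + c)) s.
  elim: l s => //= a l IH s; rewrite -!IH.
  by congr ((savg _ _ _ + savg _ _ _) / 2); lra.
have -> : tail l x = savg l (fun s => (x <= s)%R%:R) 0.
  rewrite /tail -[- x]add0r shift.
  by apply: eq_savg => y; rewrite subr_ge0.
pose f s : R := (x <= s)%R%:R; rewrite -[fun s => (x <= s)%R%:R]/f.
have fN : savg l f 0 = savg l (fun s => f (- s)) 0.
  by rewrite -savgN oppr0.
rewrite mulr_natl mulr2n {2}fN -savgD; apply: eq_savg => s; rewrite /f {fN}.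
rewrite ler_normr; case: (leP x s) => xs; case: (leP x (- s)) => xs' /=; lra.
Qed.

End SignAverage.

(** * Six large weights *)

Lemma tail_six_large (R : realType) (l : seq R) (a1 a2 a3 a4 a5 a6 t : R) :
  0 < t -> a2 <= a1 -> a3 <= a2 -> a4 <= a3 -> a5 <= a4 -> a6 <= a5 ->
  t <= 3 * a6 -> a1 + a2 <= t ->
  3 * t ^+ 2 <= 2 * sumsq [:: a1, a2, a3, a4, a5, a6 & l] ->
  (forall x, 3 * x ^+ 2 <= 2 * sumsq l -> 8^-1 <= tail l x) ->
  8^-1 <= tail [:: a1, a2, a3, a4, a5, a6 & l] t.
Proof.
move=> t0 h12 h23 h34 h45 h56 h6 h0; rewrite !sumsq_cons => hS IH.
have far x : x <= t - a1 + a2 + a3 - a4 - a5 - a6 -> 8^-1 <= tail l x.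
  move=> /(tail_antimono l); apply: le_trans.
  set y := t - _ + _ + _ - _ - _ - _; have [y0|y0] := leP y 0.
    by apply: le_trans (tail_le0 l y0); lra.
  apply: IH; suff : 3 * y ^+ 2 + 2 * (a1 ^+ 2 + a2 ^+ 2 + a3 ^+ 2 + a4 ^+ 2
    + a5 ^+ 2 + a6 ^+ 2) <= 3 * t ^+ 2 by lra.
  rewrite /y {y0 hS y}.
  (* In terms of the seven slacks of the hypotheses, which form a basis of the linear
     forms in t, a1, ..., a6, the difference has nonnegative coefficients. *)
  have e1 : 0 <= (a1 - a2) * (9 * (a1 - a2) + 40 * (a2 - a3) + 36 * (a3 - a4)
      + 32 * (a4 - a5) + 28 * (a5 - a6) + 8 * (3 * a6 - t) + 26 * (t - a1 - a2)).
    by apply: mulr_ge0; lra.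
  have e2 : 0 <= (a2 - a3) * (28 * (a2 - a3) + 36 * (a3 - a4) + 40 * (a4 - a5)
      + 44 * (a5 - a6) + 16 * (3 * a6 - t) + 40 * (t - a1 - a2)).
    by apply: mulr_ge0; lra.
  have e3 : 0 <= (a3 - a4) * (3 * (a3 - a4) + 16 * (a4 - a5) + 26 * (a5 - a6)
      + 12 * (3 * a6 - t) + 30 * (t - a1 - a2)).
    by apply: mulr_ge0; lra.
  have e4 : 0 <= (a4 - a5) * (8 * (a4 - a5) + 20 * (a5 - a6) + 8 * (3 * a6 - t)
      + 32 * (t - a1 - a2)).
    by apply: mulr_ge0; lra.
  have e5 : 0 <= (a5 - a6) * (7 * (a5 - a6) + 4 * (3 * a6 - t) + 34 * (t - a1 - a2)).
    by apply: mulr_ge0; lra.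
  have e6 : 0 <= (3 * a6 - t) * (12 * (t - a1 - a2)).
    by apply: mulr_ge0; lra.
  have e7 : 0 <= (t - a1 - a2) * (12 * (t - a1 - a2)).
    by apply: mulr_ge0; lra.
  lra.
(* The two thresholds of each pair add up to 2t minus twice the sum of three weights. *)
have p1 : 1 <= tail l (t - a1 - a2 - a3 - a4 - a5 - a6)
    + tail l (t + a1 + a2 + a3 - a4 - a5 - a6).
  by apply: tail_pair; lra.
have p2 : 1 <= tail l (t - a1 - a2 + a3 - a4 - a5 - a6)
    + tail l (t + a1 + a2 - a3 - a4 - a5 - a6).
  by apply: tail_pair; lra.
have p3 : 1 <= tail l (t - a1 - a2 - a3 + a4 - a5 - a6)
    + tail l (t + a1 - a2 + a3 - a4 - a5 - a6).
  by apply: tail_pair; lra.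
have p4 : 1 <= tail l (t - a1 - a2 - a3 - a4 + a5 - a6)
    + tail l (t + a1 - a2 - a3 + a4 - a5 - a6).
  by apply: tail_pair; lra.
have p5 : 1 <= tail l (t - a1 - a2 - a3 - a4 - a5 + a6)
    + tail l (t + a1 - a2 - a3 - a4 + a5 - a6).
  by apply: tail_pair; lra.
have p6 : 1 <= tail l (t - a1 + a2 - a3 - a4 - a5 - a6)
    + tail l (t + a1 - a2 - a3 - a4 - a5 + a6).
  by apply: tail_pair; lra.
have p7 : 1 <= tail l (t + a1 - a2 - a3 - a4 - a5 - a6)
    + tail l (t - a1 + a2 + a3 - a4 - a5 - a6).
  by apply: tail_pair; lra.
have p8 : 8^-1 <= tail l (t - a1 + a2 - a3 + a4 - a5 - a6) by apply: far; lra.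
have p9 : 8^-1 <= tail l (t - a1 + a2 - a3 - a4 + a5 - a6) by apply: far; lra.
have p10 : 8^-1 <= tail l (t - a1 + a2 - a3 - a4 - a5 + a6) by apply: far; lra.
have p11 : 8^-1 <= tail l (t - a1 - a2 + a3 + a4 - a5 - a6) by apply: far; lra.
have p12 : 8^-1 <= tail l (t - a1 - a2 + a3 - a4 + a5 - a6) by apply: far; lra.
have p13 : 8^-1 <= tail l (t - a1 - a2 + a3 - a4 - a5 + a6) by apply: far; lra.
have p14 : 8^-1 <= tail l (t - a1 - a2 - a3 + a4 + a5 - a6) by apply: far; lra.
have p15 : 8^-1 <= tail l (t - a1 - a2 - a3 + a4 - a5 + a6) by apply: far; lra.
have p16 : 8^-1 <= tail l (t - a1 - a2 - a3 - a4 + a5 + a6) by apply: far; lra.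
move: p1 p2 p3 p4 p5 p6 p7 p8 p9 p10 p11 p12 p13 p14 p15 p16.
rewrite !tail_cons; clear.
repeat match goal with |- context [tail l ?x] =>
  move: (tail l x) (tail_ge0 l x) => ? ?
end.
lra.
Qed.

(** * The trigonometric minorant *)

Lemma cos_mul3 (R : realType) (x : R) : cos (3 * x) = 4 * cos x ^+ 3 - 3 * cos x.
Proof.
rewrite (_ : 3 * x = x *+ 2 + x); last by rewrite mulr2n; lra.
rewrite cosD cos_mulr2n sin_mulr2n.
have := cos2Dsin2 x; set c := cos x; set s := sin x => h.
have -> : (c * s) *+ 2 * s = 2 * c * (1 - c ^+ 2).
  by rewrite (_ : 1 - c ^+ 2 = s ^+ 2); [ring|lra].
ring.
Qed.

Lemma cos_mul4 (R : realType) (x : R) :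
  cos (4 * x) = 8 * cos x ^+ 4 - 8 * cos x ^+ 2 + 1.
Proof.
rewrite (_ : 4 * x = x *+ 2 *+ 2); last by rewrite !mulr2n; lra.
by rewrite !cos_mulr2n; ring.
Qed.

Lemma cos_mul5 (R : realType) (x : R) :
  cos (5 * x) = 16 * cos x ^+ 5 - 20 * cos x ^+ 3 + 5 * cos x.
Proof.
have h : cos (4 * x + x) + cos (4 * x - x) = 2 * cos (4 * x) * cos x.
  by rewrite cosB cosD; ring.
rewrite (_ : 5 * x = 4 * x + x); last by lra.
move: h; rewrite (_ : 4 * x - x = 3 * x); last by lra.
by rewrite cos_mul3 cos_mul4 => h; lra.
Qed.

Lemma bernstein5_ge0 (R : realType) (l u c : R) : l <= c -> c <= u ->
  [/\ 0 <= (u - c) ^+ 5, 0 <= (c - l) * (u - c) ^+ 4 &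
      0 <= (c - l) ^+ 2 * (u - c) ^+ 3] /\
  [/\ 0 <= (c - l) ^+ 3 * (u - c) ^+ 2, 0 <= (c - l) ^+ 4 * (u - c) &
      0 <= (c - l) ^+ 5].
Proof.
rewrite -subr_ge0 => lc; rewrite -subr_ge0 => cu.
by do 2![split]; rewrite ?mulr_ge0// exprn_ge0.
Qed.

(* [minorant (3/2 * x)] lies below the indicator of [t <= `|x|] when [3 * t ^+ 2 = 2]:
   it is at most 0 where the cosine exceeds 339/1000 and at most 1 elsewhere.  The
   coefficients come from a linear program. *)
Definition minorant (R : realType) (y : R) : R :=
  461 / 1000 - 618 / 1000 * cos y + 197 / 1000 * cos (3 * y)
  + 25 / 1000 * cos (4 * y) - 88 / 1000 * cos (5 * y).

Lemma minorant_le0 (R : realType) (y : R) : 339 / 1000 <= cos y -> minorant y <= 0.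
Proof.
rewrite /minorant cos_mul3 cos_mul4 cos_mul5; have := cos_le1 y; move: (cos y) => c c1 c0.
have [h1|/ltW h1] := leP c (67 / 100).
  by have [[? ? ?] [? ? ?]] := bernstein5_ge0 c0 h1; lra.
have [h2|/ltW h2] := leP c (167 / 200).
  by have [[? ? ?] [? ? ?]] := bernstein5_ge0 h1 h2; lra.
have [h3|/ltW h3] := leP c (459 / 500).
  by have [[? ? ?] [? ? ?]] := bernstein5_ge0 h2 h3; lra.
by have [[? ? ?] [? ? ?]] := bernstein5_ge0 h3 c1; lra.
Qed.

Lemma minorant_le1 (R : realType) (y : R) : minorant y <= 1.
Proof.
rewrite /minorant cos_mul3 cos_mul4 cos_mul5.
have := cos_le1 y; have := cos_geN1 y; move: (cos y) => c c0 c1.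
have [h1|/ltW h1] := leP c (-3 / 4).
  by have [[? ? ?] [? ? ?]] := bernstein5_ge0 c0 h1; lra.
have [h2|/ltW h2] := leP c (-5 / 8).
  by have [[? ? ?] [? ? ?]] := bernstein5_ge0 h1 h2; lra.
have [h3|/ltW h3] := leP c (-281 / 500).
  by have [[? ? ?] [? ? ?]] := bernstein5_ge0 h2 h3; lra.
have [h4|/ltW h4] := leP c (-1 / 2).
  by have [[? ? ?] [? ? ?]] := bernstein5_ge0 h3 h4; lra.
have [h5|/ltW h5] := leP c 0.
  by have [[? ? ?] [? ? ?]] := bernstein5_ge0 h4 h5; lra.
by have [[? ? ?] [? ? ?]] := bernstein5_ge0 h5 c1; lra.
Qed.

Lemma minorant_le_indic (R : realType) (t x : R) : 0 < t -> 3 * t ^+ 2 = 2 ->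
  minorant (3 / 2 * x) <= (t <= `|x|)%R%:R.
Proof.
move=> t0 t2; have [_|xt] := leP t `|x|; first exact: minorant_le1.
apply: minorant_le0; rewrite -cos_norm normrM (ger0_norm (_ : 0 <= 3 / 2)); last lra.
have x0 : 0 <= `|x| by [].
have x2 : `|x| ^+ 2 <= 2 / 3 by nra.
apply: le_trans (cos_ge6 _); last by rewrite mulr_ge0//; lra.
have y2 : (3 / 2 * `|x|) ^+ 2 <= 3 / 2 by rewrite exprMn; lra.
move: (3 / 2 * `|x|) y2 => y.
rewrite (_ : y ^+ 4 = (y ^+ 2) ^+ 2); last by rewrite -exprM.
rewrite (_ : y ^+ 6 = (y ^+ 2) ^+ 3); last by rewrite -exprM.
have := sqr_ge0 y; move: (y ^+ 2) => z z0 z2.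
suff : 0 <= (3 / 2 - z) * (2^-1 - (3 / 2 + z) / 24
   + ((3 / 2) ^+ 2 + 3 / 2 * z + z ^+ 2) / 720) by lra.
apply: mulr_ge0; first by rewrite subr_ge0.
by have := sqr_ge0 z; lra.
Qed.

Definition cosprod (R : realType) (l : seq R) (u : R) : R := \prod_(a <- l) cos (u * a).

Lemma tail_ge_cosprod (R : realType) (l : seq R) (t : R) : 0 < t -> 3 * t ^+ 2 = 2 ->
  461 / 1000 - 618 / 1000 * cosprod l (3 / 2) + 197 / 1000 * cosprod l (9 / 2)
  + 25 / 1000 * cosprod l 6 - 88 / 1000 * cosprod l (15 / 2) <= 2 * tail l t.
Proof.
move=> t0 t2; rewrite -savg_norm_ge//.
apply: le_trans (savg_le _ _ (fun x => minorant_le_indic x t0 t2)).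
rewrite le_eqVlt; apply/orP; left; apply/eqP; apply/esym.
pose p u (x : R) := cos (u * x).
have pE u : savg l (p u) 0 = cosprod l u by rewrite savg_cos mulr0 cos0 mul1r.
rewrite (@eq_savg _ _ _ (fun x => 461 / 1000 + (- (618 / 1000) * p (3 / 2) x
  + (197 / 1000 * p (9 / 2) x + (25 / 1000 * p 6 x + - (88 / 1000) * p (15 / 2) x))))).
  by rewrite !savgD !savgZ savg_cst !pE; lra.
move=> x; rewrite /minorant /p.
rewrite (_ : 3 * (3 / 2 * x) = 9 / 2 * x); last lra.
rewrite (_ : 4 * (3 / 2 * x) = 6 * x); last lra.
rewrite (_ : 5 * (3 / 2 * x) = 15 / 2 * x); last lra.
lra.
Qed.

Section CosprodBounds.
Variable R : realType.
Implicit Types (l : seq R).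

Lemma cosprod_cons a l u : cosprod (a :: l) u = cos (u * a) * cosprod l u.
Proof. by rewrite /cosprod big_cons. Qed.

Lemma norm_cosprod_cons_le a l u : `|cosprod (a :: l) u| <= `|cosprod l u|.
Proof. by rewrite cosprod_cons normrM ler_piMl// cos_max. Qed.

Lemma norm_cosprod_le l u k :
  (forall a, a \in l -> `|cos (u * a)| <= expR (- (k * a ^+ 2))) ->
  `|cosprod l u| <= expR (- (k * sumsq l)).
Proof.
elim: l => [|a l IH] h; first by rewrite /cosprod /sumsq !big_nil mulr0 oppr0 expR0 normr1.
rewrite cosprod_cons sumsq_cons normrM mulrDr opprD expRD ler_pM//.
  by apply: h; rewrite inE eqxx.
by apply: IH => b bl; apply: h; rewrite inE bl orbT.
Qed.

Lemma cosprod_3half_le l :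
  (forall a, a \in l -> 0 <= a /\ 3 * a ^+ 2 <= 2) ->
  0 <= cosprod l (3 / 2) <=
    expR (- (9 / 8 * sumsq l + 27 / 64 * \sum_(a <- l) a ^+ 4)).
Proof.
elim: l => [|a l IH] h.
  by rewrite /cosprod /sumsq !big_nil !mulr0 addr0 oppr0 expR0 ler01 lexx.
have /IH/andP[p0 p1] : forall b, b \in l -> 0 <= b /\ 3 * b ^+ 2 <= 2.
  by move=> b bl; apply: h; rewrite inE bl orbT.
have [a0 a2] : 0 <= a /\ 3 * a ^+ 2 <= 2 by apply: h; rewrite inE eqxx.
have /andP[c0 c1] : 0 <= cos (3 / 2 * a) <=
    expR (- ((3 / 2 * a) ^+ 2 / 2 + (3 / 2 * a) ^+ 4 / 12)).
  by apply: cos_le_expRN4; [rewrite mulr_ge0//; lra|rewrite exprMn; lra].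
rewrite cosprod_cons sumsq_cons big_cons; apply/andP; split; first exact: mulr_ge0.
apply: le_trans (ler_pM c0 p0 c1 p1) _; rewrite -expRD ler_expR !exprMn; lra.
Qed.

End CosprodBounds.

Lemma expRN_le_pow (R : realType) (n : nat) (y B x : R) : 0 <= y -> x = n%:R * y ->
  1 - y + 2^-1 * y ^+ 2 - 6^-1 * y ^+ 3 + 24^-1 * y ^+ 4 <= B ->
  expR (- x) <= B ^+ n.
Proof.
move=> y0 -> yB; rewrite -mulrN expRM_natl.
have h := le_trans (expRN_le4 y0) yB.
by apply: lerXn2r => //; rewrite nnegrE ?expR_ge0// (le_trans _ h)// expR_ge0.
Qed.

Lemma sqr_le (R : realType) (x y : R) : 0 <= x -> x <= y -> x ^+ 2 <= y ^+ 2.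
Proof. by move=> x0 xy; apply: lerXn2r; rewrite ?nnegrE// (le_trans x0). Qed.

Lemma head_sumsq_le (R : realType) (t a1 a2 a3 a4 a5 : R) :
  a2 <= a1 -> a3 <= a2 -> a4 <= a3 -> a5 <= a4 -> 0 <= a5 -> a1 + a2 <= t ->
  4 * (a1 ^+ 2 + a2 ^+ 2 + a3 ^+ 2 + a4 ^+ 2 + a5 ^+ 2) <= 5 * t ^+ 2.
Proof.
move=> h12 h23 h34 h45 h5 h0.
have s1 : a1 ^+ 2 <= (t - a2) ^+ 2 by apply: lerXn2r; rewrite ?nnegrE; lra.
have s3 : a3 ^+ 2 <= a2 ^+ 2 by apply: lerXn2r; rewrite ?nnegrE; lra.
have s4 : a4 ^+ 2 <= a2 ^+ 2 by apply: lerXn2r; rewrite ?nnegrE; lra.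
have s5 : a5 ^+ 2 <= a2 ^+ 2 by apply: lerXn2r; rewrite ?nnegrE; lra.
have : 0 <= (t - 2 * a2) * (10 * a2 + t) by apply: mulr_ge0; lra.
lra.
Qed.

Lemma tail_sixth_small (R : realType) (r : seq R) (t a1 a2 a3 a4 a5 : R) :
  0 < t -> 3 * t ^+ 2 = 2 ->
  a2 <= a1 -> a3 <= a2 -> a4 <= a3 -> a5 <= a4 -> 0 <= a5 -> a1 + a2 <= t ->
  (forall b, b \in r -> 0 <= b /\ 27 * b ^+ 2 <= 2) ->
  sumsq [:: a1, a2, a3, a4, a5 & r] = 1 ->
  8^-1 <= tail [:: a1, a2, a3, a4, a5 & r] t.
Proof.
move=> t0 t2 h12 h23 h34 h45 h5 h0 hr; set l := [:: a1, a2, a3, a4, a5 & r] => hl.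
pose W := a1 ^+ 2 + a2 ^+ 2 + a3 ^+ 2 + a4 ^+ 2 + a5 ^+ 2.
have sumsq_r : sumsq r = 1 - W.
  by move: hl; rewrite /l !sumsq_cons /W; clear; lra.
have W_le : 6 * W <= 5.
  by have := head_sumsq_le h12 h23 h34 h45 h5 h0; rewrite /W; move: t2; lra.
have a40 := le_trans h5 h45; have a30 := le_trans a40 h34.
have a20 := le_trans a30 h23; have a10 := le_trans a20 h12.
have h24 := le_trans h34 h23; have h25 := le_trans h45 h24.
have a1T : a1 ^+ 2 <= t ^+ 2 by apply: sqr_le => //; move: h0 a20; clear; lra.
have sqr_le_half a : a \in [:: a2, a3, a4, a5 & r] -> 0 <= a /\ 6 * a ^+ 2 <= 1.
  have big b : 0 <= b -> b <= a2 -> 0 <= b /\ 6 * b ^+ 2 <= 1.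
    move=> b0 b2; split => //.
    have bt : 2 * b <= t by move: b2 h12 h0; clear; lra.
    have := sqr_le (mulr_ge0 (ler0n _ 2) b0) bt; rewrite exprMn; move: t2; clear; lra.
  rewrite !inE => /or4P[/eqP->|/eqP->|/eqP->|/orP[/eqP->|/hr[b0 b2]]];
    [exact: big|exact: big|exact: big|exact: big|].
  by split => //; move: b2; clear; lra.
have cosprod_9half : `|cosprod l (9 / 2)| <= expR (- (39 / 5 * (1 - a1 ^+ 2))).
  apply: le_trans (norm_cosprod_cons_le _ _ _) _.
  have -> : 1 - a1 ^+ 2 = sumsq [:: a2, a3, a4, a5 & r].
    by rewrite -hl /l sumsq_cons addrC addKr.
  by apply: norm_cosprod_le => a /sqr_le_half[]; exact: norm_cos_9half.
have cosprod_tail u : `|cosprod l u| <= `|cosprod r u|.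
  by do 4![apply: le_trans (norm_cosprod_cons_le _ _ _) _]; exact: norm_cosprod_cons_le.
have cosprod_6 : `|cosprod l 6| <= expR (- (18 * (1 - W))).
  apply: le_trans (cosprod_tail _) _; rewrite -sumsq_r.
  by apply: norm_cosprod_le => a /hr[]; exact: norm_cos_6.
have cosprod_15half : `|cosprod l (15 / 2)| <= expR (- (52 / 5 * (1 - W))).
  apply: le_trans (cosprod_tail _) _; rewrite -sumsq_r.
  by apply: norm_cosprod_le => a /hr[]; exact: norm_cos_15half.
have cosprod_3half : cosprod l (3 / 2) <=
  expR (- (9 / 8 + 27 / 64 * (a1 ^+ 4 + a2 ^+ 4 + a3 ^+ 4 + a4 ^+ 4 + a5 ^+ 4))).
  have h a : a \in l -> 0 <= a /\ 3 * a ^+ 2 <= 2.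
    rewrite inE => /orP[/eqP->|/sqr_le_half[? ?]]; last by split => //; lra.
    split => //.
    by move: a1T t2; clear; lra.
  have /andP[_ ] := cosprod_3half_le h; rewrite hl mulr1 => /le_trans; apply.
  rewrite ler_expR lerN2 !big_cons.
  have : 0 <= \sum_(a <- r) a ^+ 4.
    by apply: sumr_ge0 => a _; rewrite exprn_even_ge0.
  lra.
have tail_ge p1 p3 p4 p5 : cosprod l (3 / 2) <= p1 -> `|cosprod l (9 / 2)| <= p3 ->
    `|cosprod l 6| <= p4 -> `|cosprod l (15 / 2)| <= p5 ->
    618 * p1 + 197 * p3 + 25 * p4 + 88 * p5 <= 211 -> 8^-1 <= tail l t.
  have := tail_ge_cosprod l t0 t2.
  move: (cosprod _ _) (cosprod _ _) (cosprod _ _) (cosprod _ _) => q1 q3 q4 q5 h H1.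
  rewrite !ler_norml => /andP[A1 _] /andP[A2 _] /andP[_ A3] A4.
  by clear -h H1 A1 A2 A3 A4; lra.
have W0 : a1 ^+ 2 <= W by rewrite /W; clear; have := sqr_ge0 a2; have := sqr_ge0 a3;
  have := sqr_ge0 a4; have := sqr_ge0 a5; lra.
have q4 : 0 <= a1 ^+ 4 /\ 0 <= a2 ^+ 4 + a3 ^+ 4 + a4 ^+ 4 + a5 ^+ 4.
  by split; rewrite ?addr_ge0// exprn_even_ge0.
case: q4 => q41 q42.
have [b1|b1] := leP (a1 ^+ 2) (7 / 20); last first.
  have a1t : 2 * t <= 3 * a1.
    rewrite leNgt; apply/negP => h.
    have := sqr_le (mulr_ge0 (ler0n _ 3) a10) (ltW h).
    by rewrite !exprMn; move: b1 t2; clear; lra.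
  have sqr_le_third a : a \in [:: a2, a3, a4, a5 & r] -> 0 <= a /\ 27 * a ^+ 2 <= 2.
    have big b : 0 <= b -> b <= a2 -> 0 <= b /\ 27 * b ^+ 2 <= 2.
      move=> b0 b2; split => //.
      have bt : 3 * b <= t by move: b2 a1t h0; clear; lra.
      have := sqr_le (mulr_ge0 (ler0n _ 3) b0) bt; rewrite exprMn; move: t2; clear; lra.
    by rewrite !inE => /or4P[/eqP->|/eqP->|/eqP->|/orP[/eqP->|/hr//]]; exact: big.
  have E : sumsq [:: a2, a3, a4, a5 & r] = 1 - a1 ^+ 2.
    by move: hl; rewrite /l sumsq_cons; clear; lra.
  apply: (tail_ge ((746 / 1000) ^+ 4) ((523 / 1000) ^+ 4) ((375 / 1000) ^+ 6)
    ((424 / 1000) ^+ 4)).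
  - apply: le_trans cosprod_3half _.
    have b2 : (7 / 20) ^+ 2 <= (a1 ^+ 2) ^+ 2 by apply: sqr_le (ltW b1); clear; lra.
    apply: le_trans (_ : expR (- (9 / 8 + 27 / 64 * (49 / 400))) <= _).
      by rewrite ler_expR; clear -b2 q41 q42; lra.
    by apply: (@expRN_le_pow _ 4 (4 ^-1 * (9 / 8 + 27 / 64 * (49 / 400)))); clear; lra.
  - apply: le_trans cosprod_9half _.
    apply: le_trans (_ : expR (- (13 / 5)) <= _).
      by rewrite ler_expR; clear -a1T t2; lra.
    by apply: (@expRN_le_pow _ 4 (13 / 20)); clear; lra.
  - apply: le_trans (norm_cosprod_cons_le _ _ _) _.
    apply: le_trans (_ : expR (- (18 * (1 - a1 ^+ 2))) <= _).
      by rewrite -E; apply: norm_cosprod_le => a /sqr_le_third[]; exact: norm_cos_6.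
    apply: le_trans (_ : expR (- 6) <= _).
      by rewrite ler_expR; clear -a1T t2; lra.
    by apply: (@expRN_le_pow _ 6 1); clear; lra.
  - apply: le_trans (norm_cosprod_cons_le _ _ _) _.
    apply: le_trans (_ : expR (- (52 / 5 * (1 - a1 ^+ 2))) <= _).
      by rewrite -E; apply: norm_cosprod_le => a /sqr_le_third[]; exact: norm_cos_15half.
    apply: le_trans (_ : expR (- (52 / 15)) <= _).
      by rewrite ler_expR; clear -a1T t2; lra.
    by apply: (@expRN_le_pow _ 4 (13 / 15)); clear; lra.
  - by clear; lra.
have e3 : expR (- (39 / 5 * (1 - a1 ^+ 2))) <= (532 / 1000) ^+ 8.
  apply: le_trans (_ : expR (- (507 / 100)) <= _).
    by rewrite ler_expR; clear -b1; lra.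
  by apply: (@expRN_le_pow _ 8 (507 / 800)); clear; lra.
have [WW|WW] := leP W (7 / 10).
  apply: (tail_ge ((755 / 1000) ^+ 4) ((532 / 1000) ^+ 8) ((532 / 1000) ^+ 8)
    ((461 / 1000) ^+ 4)).
  - apply: le_trans cosprod_3half _.
    apply: le_trans (_ : expR (- (9 / 8)) <= _).
      by rewrite ler_expR; clear -q41 q42; lra.
    by apply: (@expRN_le_pow _ 4 (9 / 32)); clear; lra.
  - exact: le_trans cosprod_9half e3.
  - apply: le_trans cosprod_6 _.
    apply: le_trans (_ : expR (- (507 / 100)) <= _).
      by rewrite ler_expR; clear -WW; lra.
    by apply: (@expRN_le_pow _ 8 (507 / 800)); clear; lra.
  - apply: le_trans cosprod_15half _.
    apply: le_trans (_ : expR (- (78 / 25)) <= _).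
      by rewrite ler_expR; clear -WW; lra.
    by apply: (@expRN_le_pow _ 4 (39 / 50)); clear; lra.
  - by clear; lra.
(* The quartic term in the bound on [cosprod l (3 / 2)] now has to make up for the larger
   bound on [cosprod l (15 / 2)]. *)
have q5 : W ^+ 2 <= 5 * (a1 ^+ 4 + a2 ^+ 4 + a3 ^+ 4 + a4 ^+ 4 + a5 ^+ 4).
  have := sqr_ge0 (a1 ^+ 2 - a2 ^+ 2).
  have := sqr_ge0 (a1 ^+ 2 - a3 ^+ 2).
  have := sqr_ge0 (a1 ^+ 2 - a4 ^+ 2).
  have := sqr_ge0 (a1 ^+ 2 - a5 ^+ 2).
  have := sqr_ge0 (a2 ^+ 2 - a3 ^+ 2).
  have := sqr_ge0 (a2 ^+ 2 - a4 ^+ 2).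
  have := sqr_ge0 (a2 ^+ 2 - a5 ^+ 2).
  have := sqr_ge0 (a3 ^+ 2 - a4 ^+ 2).
  have := sqr_ge0 (a3 ^+ 2 - a5 ^+ 2).
  have := sqr_ge0 (a4 ^+ 2 - a5 ^+ 2).
  by rewrite /W; lra.
have W2 : (7 / 10) ^+ 2 <= W ^+ 2 by apply: sqr_le (ltW WW); clear; lra.
apply: (tail_ge ((7471 / 10000) ^+ 4) ((532 / 1000) ^+ 8) ((4742 / 10000) ^+ 4)
    ((6485 / 10000) ^+ 4)).
- apply: le_trans cosprod_3half _.
  apply: le_trans (_ : expR (- (9 / 8 + 27 / 64 * (49 / 500))) <= _).
    by rewrite ler_expR; clear -q5 W2; lra.
  by apply: (@expRN_le_pow _ 4 (4 ^-1 * (9 / 8 + 27 / 64 * (49 / 500)))); clear; lra.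
- exact: le_trans cosprod_9half e3.
- apply: le_trans cosprod_6 _.
  apply: le_trans (_ : expR (- 3) <= _).
    by rewrite ler_expR; clear -W_le; lra.
  by apply: (@expRN_le_pow _ 4 (3 / 4)); clear; lra.
- apply: le_trans cosprod_15half _.
  apply: le_trans (_ : expR (- (26 / 15)) <= _).
    by rewrite ler_expR; clear -W_le; lra.
  by apply: (@expRN_le_pow _ 4 (13 / 30)); clear; lra.
- by clear; lra.
Qed.

(** * The tail of a signed sum *)

Section TailLowerBound.
Variable R : realType.
Implicit Types (l : seq R).

Let admissible l := sorted >=%R l && all (fun a => 0 < a) l.

Let eighth l := forall x, 3 * x ^+ 2 <= 2 * sumsq l -> 8^-1 <= tail l x.

Lemma tail_unit l t : 0 < t -> 3 * t ^+ 2 = 2 -> sumsq l = 1 -> admissible l ->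
  (forall l', (size l' < size l)%N -> admissible l' -> eighth l') -> 8^-1 <= tail l t.
Proof.
move=> t0 t2 hl; have t1 : t <= 1 by nra.
case: l hl => [|a1 [|a2 l]].
- by rewrite /sumsq big_nil; lra.
- rewrite sumsq_cons /sumsq big_nil => h /andP[_ /= /andP[p1 _]] _; rewrite tail_cons.
  have a1t : t <= a1.
    rewrite leNgt; apply/negP => /ltW /(sqr_le (ltW p1)); lra.
  have := tail_ge0 [::] (t + a1); have := @tail_le0 _ [::] (t - a1); lra.
move=> hl /andP[/= /andP[h12 s2] /and3P[p1 p2 pl]] IH.
have [h0|h0] := leP t (a1 + a2).
  rewrite !tail_cons.
  have := tail_ge0 l (t - a1 + a2); have := tail_ge0 l (t + a1 - a2).
  have := tail_ge0 l (t + a1 + a2); have := @tail_le0 _ l (t - a1 - a2); lra.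
have small b3 b4 b5 : b3 <= a2 -> b4 <= b3 -> b5 <= b4 -> 0 <= b5 ->
    a1 ^+ 2 + a2 ^+ 2 + b3 ^+ 2 + b4 ^+ 2 + b5 ^+ 2 != 1.
  move=> h23 h34 h45 h5; apply/eqP => h.
  by have := head_sumsq_le h12 h23 h34 h45 h5 (ltW h0); rewrite h; lra.
have nil0 : sumsq [::] = 0 :> R by rewrite /sumsq big_nil.
have zero2 : 0 ^+ 2 = 0 :> R by rewrite expr0n.
case: l hl s2 pl IH => [|a3 l].
  rewrite !sumsq_cons nil0 => hl _ _ _.
  by have := small 0 0 0 (ltW p2) (lexx _) (lexx _) (lexx _); rewrite !zero2; lra.
move=> hl /= /andP[h23 s3] /andP[p3 pl] IH.
case: l hl s3 pl IH => [|a4 l].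
  rewrite !sumsq_cons nil0 => hl _ _ _.
  by have := small a3 0 0 h23 (ltW p3) (lexx _) (lexx _); rewrite !zero2; lra.
move=> hl /= /andP[h34 s4] /andP[p4 pl] IH.
case: l hl s4 pl IH => [|a5 l].
  rewrite !sumsq_cons nil0 => hl _ _ _.
  by have := small a3 a4 0 h23 h34 (ltW p4) (lexx _); rewrite !zero2; lra.
move=> hl /= /andP[h45 s5] /andP[p5 pl] IH.
case: l hl s5 pl IH => [|a6 l].
  rewrite !sumsq_cons nil0 => hl _ _ _.
  by have := small a3 a4 a5 h23 h34 h45 (ltW p5); lra.
move=> hl /= /andP[h56 s6] /andP[p6 pl] IH.
have [h6|h6] := leP t (3 * a6).
  apply: tail_six_large => //; [exact: ltW|by rewrite hl; lra|].
  apply: IH; first by rewrite /= ltnS; do 5!apply: leqW.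
  by rewrite /admissible (path_sorted s6) pl.
apply: tail_sixth_small => //; [exact: ltW|exact: ltW|move=> b bl].
have b6 : b <= a6.
  move: bl; rewrite inE => /orP[/eqP->//|bl].
  by have /allP/(_ _ bl) := order_path_min ge_trans s6.
have b0 : 0 < b.
  by move: bl; rewrite inE => /orP[/eqP->//|]; apply/allP.
split; first exact: ltW.
have bt : 3 * b <= t by move: b6 h6; clear; lra.
by have := sqr_le (mulr_ge0 (ler0n _ 3) (ltW b0)) bt; rewrite exprMn; move: t2; clear; lra.
Qed.

Lemma tail_ge_eighth l : sorted >=%R l -> (forall a, a \in l -> 0 < a) ->
  forall x, 3 * x ^+ 2 <= 2 * sumsq l -> 8^-1 <= tail l x.
Proof.
move=> sl /allP pl; have : admissible l by rewrite /admissible sl.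
move: {sl pl}l {2}(size l).+1 (ltnSn (size l)) => l n.
elim: n l => // n IH l; rewrite ltnS => ln adl x hx.
have [x0|x0] := leP x 0; first by have := tail_le0 l x0; lra.
have r0 : 0 < sumsq l.
  by have := exprn_gt0 2 x0; lra.
pose c := (Num.sqrt (sumsq l))^-1; pose t : R := Num.sqrt (2 / 3).
have c0 : 0 < c by rewrite invr_gt0 sqrtr_gt0.
have c2 : c ^+ 2 * sumsq l = 1.
  by rewrite exprVn sqr_sqrtr ?mulVf// ?lt0r_neq0// ltW.
have t0 : 0 < t by rewrite sqrtr_gt0; lra.
have t2 : 3 * t ^+ 2 = 2 by rewrite sqr_sqrtr; lra.
rewrite -(tail_scale _ _ c0); apply: (@le_trans _ _ (tail [seq c * a | a <- l] t)).
  apply: tail_unit => //; first by rewrite sumsq_scale.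
    move: adl; rewrite /admissible => /andP[sl pl]; apply/andP; split.
      by rewrite sorted_map; apply: sub_sorted sl => a b /= ab; rewrite ler_wpM2l// ltW.
    by rewrite all_map; apply: sub_all pl => a /= a0; rewrite mulr_gt0.
  by move=> l' hl'; apply: IH; move: hl'; rewrite size_map => /leq_trans; apply.
apply: tail_antimono; rewrite leNgt; apply/negP => h.
have : t ^+ 2 < (c * x) ^+ 2 by rewrite ltr_pXn2r// nnegrE ltW// mulr_gt0.
by have := ler_wpM2l (ltW (exprn_gt0 2 c0)) hx; rewrite exprMn; lra.
Qed.

End TailLowerBound.

(** * From lists to random variables *)

Section SignedSums.
Context {d : measure_display} {T : measurableType d} {R : realType}.
Variables (P : probability T R) (n : nat) (a : 'I_n -> R) (eps : 'I_n -> {RV P >-> R}).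
Implicit Types (s : 'I_n -> R) (k m : nat) (t : R).

Definition cylinder k s : set T :=
  \bigcap_(i in [set i : 'I_n | (i < k)%N]) eps i @^-1` [set s i].

Lemma measurable_cylinder k s : measurable (cylinder k s).
Proof.
apply: fin_bigcap_measurable => [|i _]; last exact: measurable_funPTI.
exact: finite_finset.
Qed.

Lemma cylinder_full s :
  cylinder n s = \bigcap_(i in [set` [set: 'I_n]%SET]) eps i @^-1` [set s i].
Proof. by congr bigcap; apply/seteqP; split => i //= _; rewrite inE. Qed.

Lemma measurable_norm_sum_ge t :
  measurable [set w | t <= `|rademacher_sum a eps w|].
Proof.
have mS : measurable_fun setT (rademacher_sum a eps).
  apply: measurable_sum => i; apply: measurable_funM; first exact: measurable_cst.
  exact: measurable_funP.
have := measurableT_comp (@normr_measurable R [set: R]) mS.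
move=> /(_ measurableT [set` `[t, +oo[] (measurable_itv _)).
by rewrite setTI; congr measurable; apply/seteqP; split => w /=; rewrite in_itv/= andbT.
Qed.

Hypothesis hsign : forall i, random_sign (eps i).
Hypothesis hindep : mutually_independent eps.

Lemma cylinder_full_prob s : (forall i, s i = 1 \/ s i = -1) ->
  P (cylinder n s) = (2^-1 ^+ n)%:E.
Proof.
move=> hs; rewrite cylinder_full hindep//.
rewrite (eq_bigr (fun=> (2^-1)%:E)).
  by rewrite prodEFin prodr_const cardsT card_ord.
by move=> i _; have [e1 eN1] := hsign i; case: (hs i) => ->.
Qed.

Let weights := [seq a i | i <- enum 'I_n].

Lemma cylinder_step k (hk : (k < n)%N) s c :
  let s' i := if i == Ordinal hk then c else s i in
  cylinder k.+1 s' = cylinder k s `&` eps (Ordinal hk) @^-1` [set c].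
Proof.
move=> s'; apply/seteqP; split => [w h|w [h h'] i /=].
  split; last by have /= := h (Ordinal hk) (ltnSn k); rewrite /s' eqxx.
  move=> i /= ik; have /= := h i (ltnW ik); rewrite /s'.
  by case: eqP ik => // ->; rewrite /= ltnn.
rewrite ltnS /s' => ik; case: eqP => [->//|/eqP ne].
by apply: h; rewrite /= ltn_neqAle ik andbT.
Qed.

Lemma prob_cylinder_norm_sum_ge t m k s : (k + m = n)%N ->
  (forall i, s i = 1 \/ s i = -1) ->
  ((2^-1 ^+ k * savg (drop k weights) (fun x => (t <= `|x|)%R%:R)
      (\sum_(i < n | (i < k)%N) a i * s i))%R%:E
  <= P (cylinder k s `&` [set w | (t <= `|rademacher_sum a eps w|)%R]))%E.
Proof.
have mE := measurable_norm_sum_ge t; have mC := measurable_cylinder.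
elim: m k s => [|m IH] k s km hs.
  rewrite addn0 in km; rewrite km drop_oversize; last first.
    by rewrite size_map size_enum_ord.
  rewrite /=; case: (leP t `|_|) => [ts|_]; last by rewrite mulr0 measure_ge0.
  rewrite mulr1 -(cylinder_full_prob hs) (_ : cylinder n s `&` _ = cylinder n s)//.
  apply/seteqP; split => w; first by case.
  move=> h; split => //=.
  suff -> : rademacher_sum a eps w = \sum_(i < n | (i < n)%N) a i * s i.
    by [].
  by apply: eq_big => [i|i _]; rewrite ?ltn_ord// (h i (ltn_ord i)).
have hk : (k < n)%N by rewrite -km addnS ltnS leq_addr.
pose i0 := Ordinal hk; pose sc c i := if i == i0 then c else s i.
have hsc c : c = 1 \/ c = -1 -> forall i, sc c i = 1 \/ sc c i = -1.
  by move=> hc i; rewrite /sc; case: eqP.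
have sum c : \sum_(i < n | (i < k.+1)%N) a i * sc c i =
    \sum_(i < n | (i < k)%N) a i * s i + a i0 * c.
  rewrite (bigD1 i0)/= ?ltnSn// addrC /sc eqxx; congr (_ + _).
  apply: eq_big => [i|i /andP[_ /negbTE->]//].
  by rewrite ltnS (ltn_neqAle i) andbC.
have kmS : (k.+1 + m = n)%N by rewrite addSnnS.
have h1 := IH _ _ kmS (hsc 1 (or_introl erefl)).
have hN1 := IH _ _ kmS (hsc (-1) (or_intror erefl)).
rewrite !sum mulr1 mulrN1 !cylinder_step in h1 hN1.
set E := [set w | _] in h1 hN1 mE *.
pose A c := cylinder k s `&` eps i0 @^-1` [set c] `&` E.
have mA c : measurable (A c).
  by apply: measurableI => //; apply: measurableI => //; exact: measurable_funPTI.
apply: (@le_trans _ _ (P (A (-1) `|` A 1))); last first.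
  apply: le_measure; rewrite ?inE; [exact: measurableU|exact: measurableI|].
  by move=> w [] [[? _] ?].
rewrite measureU//; last first.
  apply/seteqP; split => // w [[[_ /= e1] _] [[_ /= e2] _]].
  by move: e2; rewrite e1; lra.
apply: le_trans (leeD hN1 h1); rewrite -EFinD lee_fin.
rewrite (drop_nth 0); last by rewrite size_map size_enum_ord.
rewrite (_ : nth 0 weights k = a i0); last first.
  by rewrite (nth_map i0) ?size_enum_ord//; congr a; apply/val_inj; rewrite /= nth_enum_ord.
by rewrite /= exprS; lra.
Qed.

Lemma prob_norm_sum_ge t : 0 < t ->
  ((2 * tail weights t)%R%:E <= P [set w | (t <= `|rademacher_sum a eps w|)%R])%E.
Proof.
move=> t0; rewrite -savg_norm_ge//.
have := @prob_cylinder_norm_sum_ge t n 0 (fun=> 1) (add0n _) (fun=> or_introl erefl).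
rewrite drop0 expr0 mul1r big1//.
by rewrite (_ : cylinder 0 _ = setT) ?setTI//; apply/seteqP.
Qed.

End SignedSums.

Theorem theorem5p4 (R : realType) (d : measure_display) (T : measurableType d)
    (P : probability T R) (n : nat) (a : 'I_n -> R)
    (eps : 'I_n -> {RV P >-> R})
    (ha : rademacher_weights a)
    (hsign : forall i, random_sign (eps i))
    (hindep : mutually_independent eps) :
  ((1 / 4 : R)%:E <=
     P [set w | (2 / Num.sqrt 6 <= `|rademacher_sum a eps w|)%R])%E.
Proof.
have [adec apos asum] := ha; set t := 2 / Num.sqrt 6.
have t0 : 0 < t by rewrite divr_gt0// sqrtr_gt0.
have t2 : 3 * t ^+ 2 = 2 by rewrite exprMn exprVn sqr_sqrtr//; lra.
apply: le_trans (prob_norm_sum_ge a hsign hindep t0); rewrite lee_fin.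
set l := [seq a i | i <- enum 'I_n].
suff : 8^-1 <= tail l t by lra.
apply: tail_ge_eighth.
- rewrite sorted_map; apply: (@sub_sorted _ (fun i j : 'I_n => (i <= j)%N)).
    by move=> i j /= ij; exact: adec.
  have := iota_sorted 0 n; rewrite -val_enum_ord sorted_map.
  by apply: sub_sorted.
- by move=> _ /mapP[i _ ->].
- by rewrite /sumsq big_map big_enum/= asum; lra.
Qed.
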